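(* Let $\mathbb{K}$ be an algebraically closed field of characteristic zero, let $G$ be a commutative linear algebraic group over $\mathbb{K}$ and let $V$ be a prehomogeneous $G$-module. Then there exists a finite dimensional commutative associative $\mathbb{K}$-algebra $A$ with unit such that the $G$-module $V$ is isomorphic (equivalent) to the $G(A)$-module $A$, where $G(A)$ is the group of invertible elements of $A$ acting on $A$ by multiplication. Moreover, two prehomogeneous modules (of commutative linear algebraic groups) are equivalent if and only if the corresponding algebras are isomorphic as $\mathbb{K}$-algebras.
   Context: A prehomogeneous $G$-module is a finite dimensional $\mathbb{K}$-vector space $V$ together with a closed subgroup $G\subseteq \mathrm{GL}(V)$ (i.e. the action of $G$ on $V$ is linear and effective) such that the induced action of $G$ on $V$ has a (Zariski) open orbit. A $G$-module $V$ (with $G\subseteq\mathrm{GL}(V)$) is equivalent to a $G'$-module $V'$ (with $G'\subseteq\mathrm{GL}(V')$) if there exists an isomorphism of vector spaces $V\to V'$ such that the induced isomorphism $\mathrm{GL}(V)\to\mathrm{GL}(V')$ maps $G$ onto $G'$. For a finite dimensional commutative associative unital algebra $A$, the group $G(A)$ of invertible elements is open in $A$ and is regarded as a closed subgroup of $\mathrm{GL}(A)$ via multiplication operators, so that $A$ is a prehomogeneous $G(A)$-module. The algebra corresponding to a prehomogeneous $G$-module $V$ is an algebra $A$ such that $V$ is equivalent to the $G(A)$-module $A$. *)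

(* Defs.v *)
From HB Require Import structures.
From mathcomp Require Import all_boot all_order all_algebra.
From mathcomp Require Import mpoly.

Set Implicit Arguments.
Unset Strict Implicit.
Unset Printing Implicit Defensive.

Import GRing.Theory.
Local Open Scope ring_scope.

(* The algebra structures of the library are built on nonzero rings, which
   would exclude the zero algebra (the algebra attached to the module V = 0);
   this structure allows 1 = 0. *)
HB.mixin Record Vector_isComFinAlgebra (K : fieldType) A of Vector K A := {
  alg_one : A;
  alg_mul : A -> A -> A;
  alg_mulA : associative alg_mul;
  alg_mulC : commutative alg_mul;
  alg_mul1 : left_id alg_one alg_mul;
  alg_mulDl : left_distributive alg_mul +%R;
  alg_scaleAl : forall (c : K) (x y : A),
    c *: alg_mul x y = alg_mul (c *: x) y
}.

#[short(type="comFinAlgType")]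
HB.structure Definition ComFinAlgebra (K : fieldType) :=
  {A of Vector_isComFinAlgebra K A & Vector K A}.

Section Zariski.
Variables (K : fieldType) (V : vectType K).

Definition polyfun (p : {mpoly K[\dim {:V}]}) (v : V) : K :=
  p.@[fun i => coord (vbasis {:V}) i v].

Definition zariski_closed (S : V -> Prop) : Prop :=
  exists P : {mpoly K[\dim {:V}]} -> Prop,
    forall v, S v <-> (forall p, P p -> polyfun p v = 0).

Definition zariski_open (S : V -> Prop) : Prop :=
  zariski_closed (fun v => ~ S v).

End Zariski.

Section Modules.
Variables (K : fieldType) (V : vectType K).
Implicit Type G : 'End(V) -> Prop.

Definition GL (g : 'End(V)) : Prop := lker g = 0%VS.

(* Closedness is relative to GL(V), which is itself open in End(V). *)
Record closed_subgroup_GL G : Prop := ClosedSubgroupGL {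
  sub_GL : forall g, G g -> GL g;
  mem_id : G \1%VF;
  mem_comp : forall g h, G g -> G h -> G (g \o h)%VF;
  mem_inv : forall g, G g -> G (g^-1)%VF;
  closed_in_GL : exists2 Z : 'End(V) -> Prop, zariski_closed Z &
    forall g, GL g -> (G g <-> Z g)
}.

Definition commutative_group G : Prop :=
  forall g h, G g -> G h -> (g \o h = h \o g)%VF.

Definition orbit G (v : V) : V -> Prop := fun w => exists2 g, G g & w = g v.

Definition prehomogeneous G : Prop :=
  closed_subgroup_GL G /\ exists v : V, zariski_open (orbit G v).

End Modules.

Definition equivalent_modules (K : fieldType) (V V' : vectType K)
    (G : 'End(V) -> Prop) (G' : 'End(V') -> Prop) : Prop :=
  exists phi : 'Hom(V, V'), [/\ lker phi = 0%VS, limg phi = fullv &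
    forall g', G' g' <-> exists2 g, G g & g' = (phi \o g \o phi^-1)%VF].

Definition invertible (K : fieldType) (A : comFinAlgType K) (a : A) : Prop :=
  exists b : A, alg_mul a b = alg_one.

(* The group G(A), embedded in GL(A) by multiplication operators. *)
Definition unit_group (K : fieldType) (A : comFinAlgType K)
    (g : 'End(A)) : Prop :=
  exists2 a : A, invertible a & forall x, g x = alg_mul a x.

Definition isomorphic_algebras (K : fieldType) (A A' : comFinAlgType K) : Prop :=
  exists f : 'Hom(A, A'), [/\ bijective f, f alg_one = alg_one &
    forall x y, f (alg_mul x y) = alg_mul (f x) (f y)].

(* Main.v *)
Require Import Defs.
From HB Require Import structures.
From mathcomp Require Import all_boot all_order all_algebra.
From mathcomp Require Import mpoly.
From Stdlib Require Import Classical.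

Set Implicit Arguments.
Unset Strict Implicit.
Unset Printing Implicit Defensive.

Import GRing.Theory passmx.
Local Open Scope ring_scope.

(** Let [v] lie in the open orbit. An endomorphism commuting with [G] is
determined by its value at [v], because the orbit spans [V]. Choosing elements
of [G] that carry [v] to a basis gives, linearly in [x], an endomorphism [L x]
commuting with [G] and such that [L x v = x]; the product is [x * y = L x y].
Then [G] is contained in the unit group, and it is all of it: for a unit [a],
the open sets [Gv] and [a Gv] meet on the line through [v] and [a].

For uniqueness, an equivalence [phi] of unit groups yields the linear map
[F a = phi (a * phi^-1 1)] with [phi (a * y) = F a * phi y] for invertible
[a]; as every element is the sum of an invertible one and a scalar, this holds
for all [a], and [F] is an isomorphism of algebras. *)

(** * Open sets, lines and spanning families *)

Section ZariskiOpen.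
Variables (K : closedFieldType) (V : vectType K).

Lemma polyfun_line (p : {mpoly K[\dim {:V}]}) (v d : V) :
  exists q : {poly K}, forall t, q.[t] = polyfun p (v + t *: d).
Proof.
pose c u i := coord (vbasis {:V}) i u.
exists (\sum_(m <- msupp p)
  (p@_m)%:P * \prod_i ((c v i)%:P + (c d i)%:P * 'X) ^+ m i) => t.
rewrite /polyfun mevalE horner_sum; apply: eq_bigr => m _.
rewrite hornerM hornerC horner_prod; congr (_ * _); apply: eq_bigr => i _.
by rewrite horner_exp hornerD hornerM !hornerC hornerX linearD linearZ /= mulrC.
Qed.

(** Some polynomial defining the complement of [S] is nonzero at the given point; its restriction to
    the line is [q]. Two such lines can then be handled at a common parameter, a nonroot of the
    product. *)
Lemma zariski_open_line (S : V -> Prop) (v d : V) (t0 : K) :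
  zariski_open S -> S (v + t0 *: d) ->
  exists2 q : {poly K}, q != 0 & forall t, ~~ root q t -> S (v + t *: d).
Proof.
move=> [P closedP] S0.
have [p [Pp p0]] : exists p, P p /\ polyfun p (v + t0 *: d) <> 0.
  apply: NNPP => noP; suff: ~ S (v + t0 *: d) by apply.
  by apply/closedP => p Pp; apply: NNPP => p0; apply: noP; exists p.
have [q qE] := polyfun_line p v d.
exists q; first by apply: contra_notN p0 => /eqP q0; rewrite -qE q0 horner0.
move=> t; rewrite /root qE => /eqP pt; apply: NNPP => /closedP /(_ p Pp).
exact: pt.
Qed.

(** The line through [v] in any direction [w] meets [S] in a second point [v + t *: w], and
    subtracting [v] puts [w] in [W]. *)
Lemma zariski_open_fullv (S : V -> Prop) (v : V) (W : {vspace V}) :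
  zariski_open S -> S v -> (forall w, S w -> w \in W) -> W = fullv.
Proof.
move=> openS Sv SW; apply/vspaceP => w; rewrite memvf.
have Sv0 : S (v + 0 *: w) by rewrite scale0r addr0.
have [q q0 qS] := zariski_open_line openS Sv0.
(* The factor ['X] forces [t] to be nonzero. *)
have /closed_nonrootP[t] : q * 'X != 0 by rewrite mulf_neq0 ?polyX_eq0.
rewrite rootM rootX negb_or => /andP[/qS/SW St t0].
rewrite -[w](scalerK t0); apply: memvZ.
by rewrite -[t *: w](addKr v) memvD // memvN SW.
Qed.

End ZariskiOpen.

(** A free family in [S] that no element of [S] enlarges has a span containing [S], hence is already
    a basis. *)
Lemma generating_basis (K : fieldType) (V : vectType K) (S : V -> Prop) :
  (forall W : {vspace V}, (forall w, S w -> w \in W) -> W = fullv) ->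
  exists2 X : (\dim {:V}).-tuple V,
    basis_of {:V} X & forall i : 'I_(\dim {:V}), S X`_i.
Proof.
move=> genS.
have /(_ _ (leqnn _))[X [freeX sizeX SX]] : forall k, (k <= \dim {:V})%N ->
    exists X : seq V, [/\ free X, size X = k & forall x, x \in X -> S x].
  elim=> [_|k IHk ltk]; first by exists [::]; rewrite nil_free.
  have [X [freeX sizeX SX]] := IHk (ltnW ltk).
  have [x [Sx Xx]] : exists x, S x /\ x \notin <<X>>%VS.
    apply: NNPP => noX; move: ltk; rewrite -(genS <<X>>%VS).
      by rewrite (eqnP freeX) sizeX ltnn.
    by move=> w Sw; apply/negPn/negP => Xw; apply: noX; exists w.
  exists (x :: X); split=> [||y]; rewrite ?free_cons ?Xx //= ?sizeX //.
  by rewrite inE => /predU1P[->|/SX].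
have size_eq : size X == \dim {:V} by rewrite sizeX.
exists (Tuple size_eq) => [|i].
  by rewrite basisEfree freeX subvf sizeX leqnn.
by apply: SX; rewrite mem_nth ?sizeX.
Qed.

(** * Equivalence of modules through mutually inverse maps *)

Lemma equivalent_modulesP (K : fieldType) (V V' : vectType K)
    (G : 'End(V) -> Prop) (G' : 'End(V') -> Prop) :
  equivalent_modules G G' <->
  exists (phi : 'Hom(V, V')) (psi : 'Hom(V', V)),
    [/\ cancel phi psi, cancel psi phi & forall (g : 'End(V)) (g' : 'End(V')),
      (forall x, phi (g x) = g' (phi x)) -> (G g <-> G' g')].
Proof.
split=> [[phi [/eqP ker0 img GG']]|[phi [psi [phiK psiK GG']]]].
  have psiK : cancel phi^-1%VF phi.
    by move=> x; rewrite limg_lfunVK // img memvf.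
  exists phi, phi^-1%VF; split=> // [|g g' gg']; first exact: lker0_lfunK.
  rewrite GG'; split=> [Gg|[h Gh g'E]].
    by exists g => //; apply/lfunP => x; rewrite !comp_lfunE gg' psiK.
  suff -> : g = h by [].
  apply/lfunP => x; apply: (lker0P ker0).
  by rewrite gg' g'E !comp_lfunE lker0_lfunK.
have ker0 : lker phi == 0%VS by apply/lker0P/(can_inj phiK).
have phiVE : phi^-1%VF =1 psi by move=> x; rewrite -{1}[x]psiK lker0_lfunK.
exists phi; split=> [||g']; first exact/eqP.
  by apply/vspaceP => x; rewrite memvf -[x]psiK memv_img ?memvf.
split=> [G'g'|[g Gg ->]].
  exists (psi \o g' \o phi)%VF.
    by apply/(GG' _ g') => // x; rewrite !comp_lfunE psiK.
  by apply/lfunP => x; rewrite !comp_lfunE /= phiVE !psiK.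
by apply/(GG' g) => // x; rewrite !comp_lfunE /= phiVE phiK.
Qed.

Lemma equivalent_modules_sym (K : fieldType) (V V' : vectType K)
    (G : 'End(V) -> Prop) (G' : 'End(V') -> Prop) :
  equivalent_modules G G' -> equivalent_modules G' G.
Proof.
move=> /equivalent_modulesP[phi [psi [phiK psiK GG']]].
apply/equivalent_modulesP; exists psi, phi; split=> // g' g g'g.
by apply: iff_sym; apply: GG' => x; rewrite -{1}[x]phiK -g'g psiK.
Qed.

Lemma equivalent_modules_trans (K : fieldType) (V1 V2 V3 : vectType K)
    (G1 : 'End(V1) -> Prop) (G2 : 'End(V2) -> Prop) (G3 : 'End(V3) -> Prop) :
  equivalent_modules G1 G2 -> equivalent_modules G2 G3 ->
  equivalent_modules G1 G3.
Proof.
move=> /equivalent_modulesP[phi [psi [phiK psiK G12]]].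
move=> /equivalent_modulesP[phi' [psi' [phi'K psi'K G23]]].
apply/equivalent_modulesP; exists (phi' \o phi)%VF, (psi \o psi')%VF.
split=> [x|x|g1 g3 g13]; rewrite ?comp_lfunE ?phi'K ?psiK //.
pose g2 := (phi \o g1 \o psi)%VF.
apply: (iff_trans (B := G2 g2)).
  by apply: G12 => x; rewrite !comp_lfunE phiK.
by apply: G23 => x; have := g13 (psi x); rewrite !comp_lfunE psiK.
Qed.

(** * Algebras and their unit groups *)

Section ComFinAlgebraTheory.
Variables (K : fieldType) (A : comFinAlgType K).
Implicit Types a x y : A.

Lemma alg_mul1r : right_id alg_one (@alg_mul K A).
Proof. by move=> x; rewrite alg_mulC alg_mul1. Qed.

Lemma alg_mul_linear a : linear (@alg_mul K A a).
Proof. by move=> k x y; rewrite !(alg_mulC a) alg_mulDl alg_scaleAl. Qed.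
HB.instance Definition _ a :=
  GRing.isLinear.Build K A A *:%R (alg_mul a) (alg_mul_linear a).

End ComFinAlgebraTheory.

(** Take [s] outside the spectrum of multiplication by [a]: multiplication by [a - s *: alg_one] is
    then injective, so it reaches [alg_one] by finite dimension. *)
Lemma invertible_shift (K : closedFieldType) (A : comFinAlgType K) (a : A) :
  exists s : K, invertible (a - s *: alg_one).
Proof.
have basisA := vbasisP {:A}.
pose g : 'End(A) := linfun (alg_mul a).
pose M := mxof (vbasis {:A}) (vbasis {:A}) g.
have /closed_nonrootP[s] : char_poly M != 0.
  by rewrite monic_neq0 ?char_poly_monic.
rewrite -eigenvalue_root_char negbK => /eqP Ms0; exists s.
have ker0 : lker (g - s *: \1%VF) == 0%VS.
  by rewrite -/(leigenspace g s) (leigenspaceE basisA) Ms0 vsof0.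
exists ((g - s *: \1)^-1%VF alg_one).
have gE x : (g - s *: \1)%VF x = alg_mul (a - s *: alg_one) x.
  rewrite add_lfunE opp_lfunE scale_lfunE !lfunE /=.
  by rewrite alg_mulDl -[- (s *: alg_one)]scaleNr -alg_scaleAl alg_mul1 scaleNr.
by rewrite -gE lker0_lfunVK.
Qed.

Lemma isomorphic_unit_groups (K : fieldType) (A A' : comFinAlgType K) :
  isomorphic_algebras A A' ->
  equivalent_modules (@unit_group K A) (@unit_group K A').
Proof.
move=> [f [bijf f1 fM]]; apply/equivalent_modulesP.
have ker0 : lker f == 0%VS by apply/lker0P/bij_inj.
have fK := lker0_lfunK ker0.
have fVK : cancel f^-1%VF f by apply/(bij_can_sym bijf).
exists f, f^-1%VF; split=> // g g' gg'.
split=> [[a [b ab1] gE]|[a [b ab1] gE]].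
  exists (f a); first by exists (f b); rewrite -fM ab1.
  by move=> x; rewrite -[x in LHS]fVK -gg' gE fM fVK.
exists (f^-1%VF a).
  by exists (f^-1%VF b); apply: (can_inj fK); rewrite fM !fVK ab1.
by move=> x; apply: (can_inj fK); rewrite gg' gE fM fVK.
Qed.

Lemma unit_groups_isomorphic (K : closedFieldType) (A A' : comFinAlgType K) :
  equivalent_modules (@unit_group K A) (@unit_group K A') ->
  isomorphic_algebras A A'.
Proof.
move=> /equivalent_modulesP[phi [psi [phiK psiK GG']]].
pose F : 'Hom(A, A') := (phi \o linfun (alg_mul (psi alg_one)))%VF.
have FE a : F a = phi (alg_mul a (psi alg_one)).
  by rewrite comp_lfunE lfunE /= alg_mulC.
have F1 : F alg_one = alg_one by rewrite FE alg_mul1 psiK.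
have phiM_inv a y : invertible a -> phi (alg_mul a y) = alg_mul (F a) (phi y).
  move=> inva; pose g : 'End(A) := linfun (alg_mul a).
  have gE x : g x = alg_mul a x by rewrite lfunE.
  (* The conjugate of multiplication by [a] is multiplication by some [a']; evaluating at
     [psi alg_one] shows that [a'] is [F a]. *)
  have [a' _ g'E] : unit_group (phi \o g \o psi)%VF.
    apply/(GG' g); last by exists a.
    by move=> x; rewrite !comp_lfunE phiK.
  have phig x : phi (g x) = alg_mul a' (phi x).
    by rewrite -g'E !comp_lfunE phiK.
  by rewrite FE -!gE !phig psiK alg_mul1r.
have phiM a y : phi (alg_mul a y) = alg_mul (F a) (phi y).
  have [s inv_as] := invertible_shift a.
  rewrite -(subrK (s *: alg_one) a); move: (a - _) inv_as => b inv_b.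
  rewrite alg_mulDl -alg_scaleAl alg_mul1 !linearD !linearZ /= F1 phiM_inv //.
  by rewrite alg_mulDl -alg_scaleAl alg_mul1.
have FM x y : F (alg_mul x y) = alg_mul (F x) (F y).
  by rewrite [F y]FE -phiM alg_mulA -FE.
exists F; split=> //.
(* [phi] is [F] followed by multiplication by the unit [phi alg_one], so [F] inherits bijectivity
   from [phi]. *)
have phiE a : phi a = alg_mul (F a) (phi alg_one) by rewrite -phiM alg_mul1r.
have phi1F : alg_mul (phi alg_one) (F (psi alg_one)) = alg_one.
  by rewrite alg_mulC -phiE psiK.
exists (fun x => psi (alg_mul x (phi alg_one))) => [a|x]; first by rewrite -phiE.
rewrite -[LHS]alg_mul1r -phi1F alg_mulA -phiE psiK.
by rewrite -alg_mulA phi1F alg_mul1r.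
Qed.

(** * The algebra of a commutative prehomogeneous module *)

Section CommutativePrehomogeneous.
Variables (K : closedFieldType) (V : vectType K) (G : 'End(V) -> Prop).
Hypotheses (commG : commutative_group G) (GV : closed_subgroup_GL G).
Variable v : V.
Hypothesis open_orbit : zariski_open (Defs.orbit G v).

Definition centralizes (h : 'End(V)) := forall g, G g -> (h \o g = g \o h)%VF.

Lemma orbit_span (W : {vspace V}) :
  (forall w, Defs.orbit G v w -> w \in W) -> W = fullv.
Proof.
apply: (zariski_open_fullv open_orbit (v := v)).
by exists \1%VF; [exact: mem_id GV | rewrite lfunE].
Qed.

Lemma centralizes_inj (h k : 'End(V)) :
  centralizes h -> centralizes k -> h v = k v -> h = k.
Proof.
move=> centh centk hkv; apply/lfunP => x; apply/eqlfunP.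
rewrite (_ : lker (h - k) = fullv) ?memvf //.
apply: orbit_span => _ [g Gg ->]; apply/eqlfunP.
by rewrite -!comp_lfunE centh // centk // !comp_lfunE hkv.
Qed.

(* Centralizing the centralizer of [G], and not only [G], is what makes the
   values of [L] commute with each other. *)
Lemma bicentralizer_section :
  exists L : {linear V -> 'End(V)}, forall x,
    (forall h, centralizes h -> (h \o L x = L x \o h)%VF) /\ L x v = x.
Proof.
have [X basisX orbX] := generating_basis orbit_span.
have /fin_all_exists[g gP] (i : 'I_(\dim {:V})) :
    exists g, G g /\ X`_i = g v.
  by have [g Gg Xi] := orbX i; exists g.
(* As a combination of elements of [G], [L x] commutes with everything that centralizes [G]. *)
pose L x : 'End(V) := \sum_i coord X i x *: g i.
have L_linear : linear L.
  move=> k x y; rewrite /L scaler_sumr -big_split; apply: eq_bigr => i _ /=.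
  by rewrite linearP scalerDl scalerA.
pose L_mixin := GRing.isLinear.Build K V 'End(V) *:%R L L_linear.
pose lin_L : {linear V -> 'End(V)} := HB.pack L L_mixin.
exists lin_L => x /=; split=> [h centh|].
  apply/lfunP => y; rewrite !comp_lfunE /L !sum_lfunE linear_sum /=.
  apply: eq_bigr => i _; rewrite !scale_lfunE linearZ /= -!comp_lfunE.
  by rewrite (centh _ (gP i).1).
rewrite /L sum_lfunE [RHS](coord_basis basisX (memvf x)).
by apply: eq_bigr => i _; rewrite scale_lfunE -(gP i).2.
Qed.

Lemma prehomogeneous_algebra :
  exists A : comFinAlgType K, equivalent_modules G (@unit_group K A).
Proof.
have [L LP] := bicentralizer_section.
have Lv x : L x v = x by have [] := LP x.
have centG g : G g -> centralizes g by move=> Gg h Gh; apply: commG.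
have centL x : centralizes (L x).
  by move=> g Gg; have [<-] := LP x; last exact: centG.
have LE h : centralizes h -> h = L (h v) by move=> ch; apply: centralizes_inj.
have centM g h : centralizes g -> centralizes h -> centralizes (g \o h)%VF.
  by move=> cg ch k Gk; rewrite -comp_lfunA ch // comp_lfunA cg // comp_lfunA.
(* Both sides centralize [G] and send [v] to [L x y]; this becomes associativity. *)
have LM x y : L (L x y) = (L x \o L y)%VF.
  by rewrite (LE (L x \o L y)%VF) ?comp_lfunE ?Lv //; apply: centM.
have L1 : L v = \1%VF.
  rewrite (LE \1%VF) ?lfunE // => h _.
  by rewrite comp_lfun1l comp_lfun1r.
have mulA : associative (fun x y => L x y).
  by move=> x y z; rewrite LM comp_lfunE.
have mulC : commutative (fun x y => L x y).
  move=> x y; rewrite -{1}[y]Lv -{2}[x]Lv -!comp_lfunE.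
  by have [->] := LP y.
have mul1 : left_id v (fun x y => L x y) by move=> x; rewrite L1 lfunE.
have mulDl : left_distributive (fun x y => L x y) +%R.
  by move=> x y z; rewrite linearD lfunE.
have scaleAl (c : K) (x y : V) : c *: L x y = L (c *: x) y.
  by rewrite linearZ lfunE.
pose mixinA := Vector_isComFinAlgebra.Build K V mulA mulC mul1 mulDl scaleAl.
pose A : comFinAlgType K := HB.pack (Vector.sort V) mixinA.
(* As a vector space [A] is [V], with unit [v], so the identity map serves and it remains to compare
   [G] with the unit group. *)
exists A; apply/equivalent_modulesP; exists \1%VF, \1%VF.
split=> [x|x|g g' gg']; rewrite ?lfunE //=.
have {g' gg'} <- : g = g'.
  by apply/lfunP => x; have := gg' x; rewrite !lfunE.
split=> [Gg|[a [b ab1] gE]].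
  exists (g v); last by move=> x; rewrite [in LHS](LE g (centG _ Gg)).
  exists (g^-1%VF v); rewrite /alg_mul /alg_one /=.
  by rewrite -(LE _ (centG _ Gg)) lker0_lfunVK //; apply/eqP/(sub_GL GV).
have {gE ab1} [-> ab1] : g = L a /\ L a b = v by split=> //; apply/lfunP.
have LaK : (L a \o L b)%VF = \1%VF by rewrite -LM ab1.
have orb_v : Defs.orbit G v v.
  by exists \1%VF; [exact: mem_id GV | rewrite lfunE].
(* The orbit of [v] meets its translate by [a] on the line through [v] and
   [a], which [L b] maps to the line through [b] and [v]. *)
have orb_v0 : Defs.orbit G v (v + 0 *: (a - v)) by rewrite scale0r addr0.
have orb_v1 : Defs.orbit G v (b + 1 *: (v - b)) by rewrite scale1r subrKC.
have [q q0 qP] := zariski_open_line open_orbit orb_v0.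
have [r r0 rP] := zariski_open_line open_orbit orb_v1.
have /closed_nonrootP[t] : q * r != 0 by rewrite mulf_neq0.
rewrite rootM negb_or => /andP[/qP[h Gh hE] /rP[k Gk kE]].
(* At the common parameter [t], [L b] carries [h v] on the first line to [k v] on the second. As
   [L a] inverts [L b], this gives [L a] as [h] composed with the inverse of [k]. *)
have hk : (L b \o h = k)%VF.
  apply: centralizes_inj; [exact: centM (centG _ Gh)|exact: centG|].
  rewrite comp_lfunE -hE -kE linearD linearZ /= linearB /= Lv.
  by rewrite (mulC b a) ab1.
have ker_k : lker k == 0%VS by apply/eqP/(sub_GL GV).
suff -> : L a = (h \o k^-1)%VF by apply: (mem_comp GV) => //; apply: mem_inv.
rewrite -[h]comp_lfun1l -LaK -comp_lfunA -comp_lfunA (comp_lfunA (L b)) hk.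
by rewrite lker0_compfV ?comp_lfun1r.
Qed.

End CommutativePrehomogeneous.

Theorem theorem1 (K : closedFieldType) (charK0 : [pchar K]%R =i pred0) :
  (forall (V : vectType K) (G : 'End(V) -> Prop),
     commutative_group G -> prehomogeneous G ->
     exists A : comFinAlgType K, equivalent_modules G (@unit_group K A))
  /\
  (forall (V V' : vectType K) (G : 'End(V) -> Prop) (G' : 'End(V') -> Prop),
     commutative_group G -> prehomogeneous G ->
     commutative_group G' -> prehomogeneous G' ->
     forall A A' : comFinAlgType K,
       equivalent_modules G (@unit_group K A) ->
       equivalent_modules G' (@unit_group K A') ->
       (equivalent_modules G G' <-> isomorphic_algebras A A')).
Proof.
split=> [V G commG [GV [v open_orbit]]|V V' G G' _ _ _ _ A A' GA GA'].
  exact: (prehomogeneous_algebra commG GV open_orbit).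
split=> [GG'|/isomorphic_unit_groups AA'].
  apply: unit_groups_isomorphic.
  apply: equivalent_modules_trans (equivalent_modules_sym GA) _.
  exact: equivalent_modules_trans GG' GA'.
apply: (equivalent_modules_trans GA).
exact: equivalent_modules_trans AA' (equivalent_modules_sym GA').
Qed.
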